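(* Every countably generated differential space $(M,\mathcal{C})$ is smoothly real-compact.
   Context: Let $M$ be a nonempty set and $\mathcal{C}$ a set of real functions on $M$. $\tau_{\mathcal{C}}$ is the weakest topology on $M$ making all functions in $\mathcal{C}$ continuous. $sc\,\mathcal{C}$ is the set of all functions $\omega\circ(f_1,\dots,f_n)$ with $n\in\mathbb{N}$, $f_1,\dots,f_n\in\mathcal{C}$, $\omega\in C^\infty(\mathbb{R}^n)$. For $A\subseteq M$, $\mathcal{C}_A$ is the set of all $f:A\to\mathbb{R}$ such that for every $p\in A$ there are an open neighbourhood $U\in\tau_{\mathcal{C}}$ of $p$ and $g\in\mathcal{C}$ with $f|_{U\cap A}=g|_{U\cap A}$. $\mathcal{C}$ is a differential structure on $M$ if $\mathcal{C}=sc\,\mathcal{C}$ and $\mathcal{C}=\mathcal{C}_M$; then $(M,\mathcal{C})$ is a differential space, and $\mathcal{C}$ is a unital real algebra. The structure $\mathcal{C}$ is generated by a set $\mathcal{C}_0$ of real functions on $M$ if $\mathcal{C}=(sc\,\mathcal{C}_0)_M$. $(M,\mathcal{C})$ is finitely generated if $\mathcal{C}$ is generated by a finite set of real functions; it is countably generated if $\mathcal{C}$ is generated by a countable set of real functions but $(M,\mathcal{C})$ is not finitely generated. The spectrum $\operatorname{Spec}\mathcal{C}$ is the set of unit-preserving algebra homomorphisms $\chi:\mathcal{C}\to\mathbb{R}$. For $p\in M$, $ev_p\in\operatorname{Spec}\mathcal{C}$ is $ev_p(f)=f(p)$. $(M,\mathcal{C})$ is smoothly real-compact if every $\chi\in\operatorname{Spec}\mathcal{C}$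 equals $ev_p$ for some $p\in M$. *)

(* Defs.v *)
(* MathComp-Analysis development, over an arbitrary [R : realType]. *)
From HB Require Import structures.
From mathcomp Require Export all_boot all_order all_algebra.
From mathcomp Require Export all_classical all_reals all_analysis.
Export Order.TTheory GRing.Theory Num.Theory.
Export numFieldNormedType.Exports.

Set Implicit Arguments.
Unset Strict Implicit.
Unset Printing Implicit Defensive.

Local Open Scope classical_set_scope.
Local Open Scope ring_scope.

Section Smooth.
Context {R : realType} {n : nat}.
Implicit Types f : 'rV[R]_n -> R.

Definition partial (i : 'I_n) f : 'rV[R]_n -> R :=
  'D_(delta_mx 0 i : 'rV[R]_n) f.

(* [iter_partial [:: i1; ...; ik] f] is d_i1 (d_i2 (... (d_ik f))). *)
Definition iter_partial (s : seq 'I_n) f : 'rV[R]_n -> R :=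
  foldr partial f s.

(* C^oo(R^n). The derivability clause is needed because ['D_v f x] is a total
   operator with a junk value where the limit does not exist. *)
Definition smooth f : Prop :=
  forall s : seq 'I_n,
    continuous (iter_partial s f) /\
    forall (i : 'I_n) (x : 'rV[R]_n),
      derivable (iter_partial s f) x (delta_mx 0 i).

End Smooth.

Section DifferentialSpaces.
Context {R : realType} {M : choiceType}.
Implicit Types C : set (M -> R).

(* tau_C, the coarsest topology on M for which every member of C is continuous:
   the supremum of the initial topologies of the members of C. *)
Definition tau C : topologicalType :=
  @sup_topology M {f : M -> R | C f}
    (fun f => Topological.class (initial_topology (sval f))).

(* The length n is allowed to be 0, so that sc of any set contains the
   constant functions; for nonempty C this makes no difference. *)
Definition sc C : set (M -> R) :=
  [set g | exists (n : nat) (f : 'I_n -> M -> R) (w : 'rV[R]_n -> R),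
     [/\ forall i, C (f i), smooth w & g = fun x => w (\row_i f i x)]].

(* C_A in the case A = M. *)
Definition localization C : set (M -> R) :=
  [set f | forall p : M, exists (U : set (tau C)) (g : M -> R),
     [/\ open U, U p, C g & forall x, U x -> f x = g x]].

Definition differential_structure C : Prop :=
  C = sc C /\ C = localization C.

Definition generated_by C C0 : Prop := C = localization (sc C0).

Definition finitely_generated C : Prop :=
  exists2 C0 : set (M -> R), finite_set C0 & generated_by C C0.

Definition countably_generated C : Prop :=
  (exists2 C0 : set (M -> R), countable C0 & generated_by C C0) /\
  ~ finitely_generated C.

(* A differential structure is closed under the pointwise operations and
   contains the constant 1, so each clause below ranges over all arguments:
   h is the sum, the product, the scalar multiple or the unit in C. *)
Definition Spec C : set ({f : M -> R | C f} -> R) :=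
  [set chi |
    [/\ forall f g h, sval h = sval f + sval g -> chi h = chi f + chi g,
        forall f g h, sval h = sval f * sval g -> chi h = chi f * chi g,
        forall (a : R) f h, sval h = (fun x => a * sval f x) ->
          chi h = a * chi f
      & forall h, sval h = cst 1 -> chi h = 1]].
Arguments Spec : clear implicits.

Definition ev C (p : M) : {f : M -> R | C f} -> R := fun f => sval f p.
Arguments ev : clear implicits.

Definition smoothly_real_compact C : Prop :=
  forall chi, Spec C chi -> exists p : M, chi = ev C p.

End DifferentialSpaces.

Arguments Spec {R M} C.
Arguments ev {R M} C p.

(* Main.v *)
Require Import Defs.
From mathcomp Require Import ring lra.

Set Implicit Arguments.
Unset Strict Implicit.
Unset Printing Implicit Defensive.

Local Open Scope classical_set_scope.
Local Open Scope ring_scope.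

(** Fix a character [chi] of [C].

    If [h] in [C] is everywhere positive then [h^-1] is in [C], because near a
    point where [h > s > 0] it is a smooth function of [h].  So an element
    killed by [chi] cannot be positive everywhere.  Applied to
    [(f - chi f)^2] this shows that [chi f] is a value of [f]
    ([character_attained]); applied to a finite sum of such squares, that
    finitely many elements take the values prescribed by [chi] at a common
    point.

    The step to a sequence [g_n] ([character_attained_seq]) is where
    countability enters.  Let [S_n] be the sum of [(g_i - chi g_i)^2] over
    [i < n]; it lies in the kernel of [chi].  If the [g_n - chi g_n] had no
    common zero, then every point would have a neighbourhood on which [S_m] is
    bounded below by a positive constant for some [m], so the sum [H] of the
    functions [flat 0 (1 - n S_n)] would be locally finite and belong to [C].
    But [H] is large where [S_N] vanishes: the first [N] terms there all equal
    [flat 0 1 > 0].  Hence for [N] large [(H - chi H)^2 + S_N], which [chi]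
    kills, is everywhere positive, a contradiction.

    Now let [C] be generated by a countable [C0].  The sequence lemma gives a
    point [p] with [g p = chi g] for all [g] in [C0], and, for each [f] in
    [C], a point [q] with the same property and moreover [f q = chi f].
    The points [p] and [q] are not separated by [C0], hence neither by the
    topology nor by the functions built from [C0], so [f p = f q = chi f].

    Both the inverse and the locally finite sum need functions on [R] that are
    smooth but not analytic.  All the smooth functions used here are built from
    constants and coordinates by algebraic operations and composition with
    functions such as [t |-> exp (-1/t)] for [t > 0], [0] for [t <= 0]; the
    inductive predicate [tame] collects the functions so obtained. *)

(** * The flat function and the smooth functions built from it *)

(** The powers of [t^-1] make the family closed under differentiation; [flat 0]
    is the classical smooth function that vanishes exactly on [t <= 0]. *)
Definition flat {R : realType} (k : nat) (t : R) : R :=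
  if 0 < t then t^-1 ^+ k * expR (- t^-1) else 0.

Lemma flat_le0 (R : realType) k (t : R) : t <= 0 -> flat k t = 0.
Proof. by rewrite /flat ltNge => ->. Qed.

Lemma flat_gt0 (R : realType) k (t : R) : 0 < t -> 0 < flat k t.
Proof.
by move=> t0; rewrite /flat t0 mulr_gt0 ?expR_gt0// exprn_gt0// invr_gt0.
Qed.

Lemma flat_ge0 (R : realType) k (t : R) : 0 <= flat k t.
Proof. by have [/flat_le0->|/flat_gt0 t0] := leP t 0; last exact: ltW. Qed.

(** [exp (1/t)] dominates [(1/t)^(k+2) / (k+2)!], one term of its series; the
    resulting order of vanishing is what differentiability at [0] needs. *)
Lemma flat_quadratic (R : realType) k (t : R) :
  flat k t <= k.+2`!%:R * t ^+ 2.
Proof.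
have [t0|t0] := leP t 0; first by rewrite flat_le0// mulr_ge0// sqr_ge0.
have tV0 : 0 < t^-1 by rewrite invr_gt0.
have E0 := expR_gt0 t^-1.
rewrite /flat t0 expRN ler_pdivrMr//.
have F0 : 0 < k.+2`!%:R :> R by rewrite ltr0n fact_gt0.
have := @expR_ge1Dxn R t^-1 k.+1 (ltW tV0).
set F := k.+2`!%:R in F0 *; set E := expR _ in E0 *; set u := t^-1.
move=> h.
have {}h : u ^+ k.+2 <= F * E.
  rewrite mulrC -ler_pdivrMr//; apply: le_trans h.
  by rewrite lerDr.
rewrite mulrAC.
have -> : u ^+ k = u ^+ k.+2 * t ^+ 2.
  by rewrite -addn2 exprD -mulrA -exprMn /u mulVf ?gt_eqF// expr1n mulr1.
by apply: ler_pM => //; rewrite ?exprn_ge0 ?sqr_ge0// ltW.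
Qed.

Lemma is_derive_quadratic (R : realType) (f : R -> R) (c : R) :
  (forall t, `|f t| <= c * t ^+ 2) -> is_derive (0 : R) (1 : R) f 0.
Proof.
move=> fc.
have f0 : f 0 = 0.
  by apply/eqP; rewrite -normr_le0 (le_trans (fc 0))// expr0n mulr0.
have L : h^-1 *: (f (h *: (1 : R) + 0) - f 0) @[h --> 0^'] --> (0 : R).
  apply/cvgr0Pnorm_le => e e0; near=> h.
  have h0 : h != 0 by near: h; exact: nbhs_dnbhs_neq.
  rewrite f0 subr0 addr0 [_ *: 1]mulr1 [_ *: _]/(_ * _) normrM normfV mulrC.
  rewrite ler_pdivrMr ?normr_gt0//; apply: le_trans (fc _) _.
  rewrite -real_normK ?num_real// expr2 mulrA ler_wpM2r//.
  apply: (@le_trans _ _ ((`|c| + 1) * `|h|)).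
    by rewrite ler_wpM2r// (le_trans (ler_norm _))// lerDl.
  rewrite mulrC -ler_pdivlMr ?ltr_wpDl//.
  near: h; apply: dnbhs0_le; rewrite divr_gt0// ltr_wpDl//.
by split; [apply/cvg_ex; exists 0 | exact: cvg_lim].
Unshelve. all: by end_near. Qed.

Lemma is_derive_flat (R : realType) k (t : R) :
  is_derive t (1 : R) (flat k) (flat k.+2 t - k%:R * flat k.+1 t).
Proof.
have [t0|t0|->] := ltgtP t 0.
- rewrite !flat_le0 ?(ltW t0)// mulr0 subr0.
  apply: (@near_eq_is_derive _ _ _ (cst 0)).
  near=> s; rewrite flat_le0//; apply: ltW; near: s; exact: lt_nbhsl.
- have tn0 : t != 0 by rewrite gt_eqF.
  apply: (@near_eq_is_derive _ _ _
            ((fun s : R => s^-1) ^+ k * (expR \o (fun s : R => - s^-1)))).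
    near=> s; rewrite /flat ifT; last by near: s; exact: lt_nbhsr.
    by rewrite fctE exprfctE.
  have dV : is_derive t (1 : R) (fun s : R => s^-1) (- t^-1 ^+ 2).
    split; first by apply: derivableV => //; exact: derivable_id.
    by rewrite (@deriveV _ _ id)// derive_id [_ *: _]mulr1 exprVn.
  (* the product rule scales by elements of [R] seen as a module over itself *)
  have mulr_regl (a b : R) : a *: b = a * b by [].
  apply: is_derive_eq; rewrite /flat t0 !mulr_regl exprfctE /=.
  by case: k => [|k]; rewrite /= ?exprS; ring.
- rewrite !flat_le0// mulr0 subr0.
  apply: (@is_derive_quadratic _ _ (k.+2`!%:R)) => s.
  by rewrite ger0_norm ?flat_ge0// flat_quadratic.
Unshelve. all: by end_near.
Qed.

Section Tame.
Context {R : realType} {n : nat}.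
Implicit Types f g : 'rV[R]_n -> R.

(** Smoothness quantifies over all iterated partial derivatives.  Describing
    functions by the way they are built reduces it to one step: each
    constructor is differentiable with tame partial derivatives.  Flat
    functions of every order [k] are included because [flat k] differentiates
    into orders [k.+1] and [k.+2]. *)
Inductive tame : ('rV[R]_n -> R) -> Prop :=
| tame_cst a : tame (fun=> a)
| tame_coord i : tame (fun x => x 0 i)
| tameD f g : tame f -> tame g -> tame (fun x => f x + g x)
| tameM f g : tame f -> tame g -> tame (fun x => f x * g x)
| tameV f : (forall x, f x != 0) -> tame f -> tame (fun x => (f x)^-1)
| tame_flat k f : tame f -> tame (fun x => flat k (f x)).

Lemma differentiable_flat k (t : R) : differentiable (flat k) t.
Proof. by apply/derivable1_diffP; case: (is_derive_flat k t). Qed.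

Lemma tame_differentiable f x : tame f -> differentiable f x.
Proof.
elim=> {f} [a|i|f g _ df _ dg|f g _ df _ dg|f f0 _ df|k f _ df].
- exact: differentiable_cst.
- exact: differentiable_coord.
- exact: differentiableD.
- exact: differentiableM.
- exact: differentiableV.
- exact: (differentiable_comp df (differentiable_flat k (f x))).
Qed.

Lemma derive_comp_real f (h : R -> R) x v :
  differentiable f x -> differentiable h (f x) ->
  'D_v (fun y => h (f y)) x = 'D_1 h (f x) * 'D_v f x.
Proof.
move=> df dh; have dhf := differentiable_comp df dh.
rewrite (deriveE v dhf) (diff_comp df dh) /= -(deriveE v df).
by rewrite (diff1E dh) derive1E mulrC.
Qed.

Lemma tame_partial i f : tame f -> tame (partial i f).
Proof.
elim=> {f} [a|j|f g tf dtf tg dtg|f g tf dtf tg dtg|f f0 tf dtf|k f tf dtf].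
- rewrite (_ : partial _ _ = fun=> 0); first exact: tame_cst.
  by apply/funext => x; rewrite /partial (derive_cst a).
- rewrite (_ : partial _ _ = fun=> (j == i)%:R); first exact: tame_cst.
  apply/funext => x; rewrite /partial.
  have /matrixP/(_ 0 j) := derive_mx (@derivable_id _ _ x (delta_mx 0 i)).
  by rewrite derive_id !mxE eqxx.
- rewrite (_ : partial _ _ = fun x => partial i f x + partial i g x).
    exact: tameD.
  apply/funext => x; rewrite /partial.
  by apply: (deriveD (f := f) (g := g)); apply/diff_derivable/tame_differentiable.
- rewrite (_ : partial _ _ =
             fun x => f x * partial i g x + g x * partial i f x).
    by apply: tameD; apply: tameM.
  apply/funext => x; rewrite /partial.
  by apply: (deriveM (f := f) (g := g)); apply/diff_derivable/tame_differentiable.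
- rewrite (_ : partial _ _ =
             fun x => -1 * ((f x)^-1 * (f x)^-1) * partial i f x).
    by apply: tameM => //; apply: tameM; [exact: tame_cst|apply: tameM; exact: tameV].
  apply/funext => x; rewrite /partial deriveV//; last first.
    exact/diff_derivable/tame_differentiable.
  by rewrite mulN1r expr2 invfM.
- rewrite (_ : partial _ _ = fun x =>
    (flat k.+2 (f x) + (- k%:R) * flat k.+1 (f x)) * partial i f x).
    by apply: tameM => //; apply: tameD; [|apply: tameM; first exact: tame_cst];
      exact: tame_flat.
  apply/funext => x; rewrite /partial derive_comp_real.
  + by have /@derive_val-> := is_derive_flat k (f x); rewrite mulNr.
  + exact: tame_differentiable.
  + exact: differentiable_flat.
Qed.

Lemma tame_smooth f : tame f -> smooth f.
Proof.
move=> tf s; have ts : tame (iter_partial s f).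
  by elim: s => //= i s; exact: tame_partial.
split=> [x|i x]; first exact/differentiable_continuous/tame_differentiable.
exact/diff_derivable/tame_differentiable.
Qed.
End Tame.

(** * The initial topology and localization *)

Section InitialTopology.
Context {R : realType} {M : choiceType}.
Implicit Types C : set (M -> R).

Lemma tau_continuous C f : C f -> continuous (f : tau C -> R).
Proof.
move=> Cf p; pose i : {f : M -> R | C f} := exist _ f Cf.
have nf : Filter (nbhs (p : tau C)) by exact: nbhs_filter.
have [+ _] := @cvg_sup _ _ (fun f : {f : M -> R | C f} =>
  Topological.class (initial_topology (sval f))) (nbhs (p : tau C)) p nf.
move=> /(_ (fun A => id) i) h A fA; apply: h.
exact: (@initial_continuous M R f p).
Qed.

Lemma open_superlevel C f c : C f -> open ([set x | c < f x] : set (tau C)).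
Proof.
move=> Cf; have /continuousP/(_ [set t | c < t]) := tau_continuous Cf.
by apply; exact: open_gt.
Qed.

(** Points not separated by [C] are topologically indistinguishable: the
    principal filter at [q] converges to [p], since it does so in the initial
    topology of each [f] in [C]. *)
Lemma tau_indistinguishable C p q (U : set (tau C)) :
  (forall f, C f -> f p = f q) -> open U -> U p -> U q.
Proof.
move=> pq oU Up.
have /(_ U (open_nbhs_nbhs (conj oU Up))) :
    principal_filter (q : M) --> (p : tau C).
  apply/cvg_sup => -[f Cf] A /=.
  move=> -[_ [[B oB <-] Bp BA]].
  rewrite nbhs_filterE; apply/principal_filterP/BA.
  by rewrite /preimage /= -(pq _ Cf).
by rewrite nbhs_filterE => /principal_filterP.
Qed.

Lemma sub_generated C f : C f -> localization (sc C) f.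
Proof.
move=> Cf p; exists setT, f; split=> //; first exact: openT.
exists 1%N, (fun=> f), (fun x => x 0 0); split=> //.
  by apply: tame_smooth; exact: tame_coord.
by apply/funext => x; rewrite mxE.
Qed.

Lemma sc_separates C p q f :
  (forall g, C g -> g p = g q) -> sc C f -> f p = f q.
Proof.
move=> pq [n [g [w [Cg _ ->]]]] /=; congr w.
by apply/rowP => i; rewrite !mxE pq.
Qed.

Lemma localization_separates C p q f :
  (forall g, C g -> g p = g q) -> localization C f -> f p = f q.
Proof.
move=> pq /(_ p)[U [g [oU Up Cg fg]]].
by rewrite !fg ?(pq g)//; exact: tau_indistinguishable Up.
Qed.

End InitialTopology.

(** * Closure properties of a differential structure *)

Section DifferentialStructure.
Context {R : realType} {M : choiceType}.
Context {C : set (M -> R)} (hC : differential_structure C).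
Implicit Types f g h : M -> R.

Lemma structure_smooth n (f : 'I_n -> M -> R) w :
  (forall i, C (f i)) -> smooth w -> C (fun x => w (\row_i f i x)).
Proof. by move=> Cf sw; rewrite hC.1; exists n, f, w. Qed.

Lemma structure_cst a : C (fun=> a).
Proof.
apply: (@structure_smooth 0 (fun=> cst 0) (fun=> a)); first by case.
by apply: tame_smooth; exact: tame_cst.
Qed.

Lemma structure_tame1 w f : tame w -> C f -> C (fun x => w (\row_(i < 1) f x)).
Proof. by move=> tw Cf; apply: structure_smooth => //; exact: tame_smooth. Qed.

Lemma structure_tame2 w f g : tame w -> C f -> C g ->
  C (fun x => w (\row_(i < 2) if i == 0 then f x else g x)).
Proof.
move=> tw Cf Cg.
have := @structure_smooth 2 (fun i => if i == 0 then f else g) w.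
move=> /(_ _ (tame_smooth tw)).
rewrite (_ : (fun x => w _) = (fun x => w (\row_(i < 2) if i == 0 then f x else g x))).
  by apply=> i; case: ifP.
by apply/funext => x; congr w; apply/rowP => i; rewrite !mxE; case: ifP.
Qed.

Lemma structureD f g : C f -> C g -> C (fun x => f x + g x).
Proof.
move=> Cf Cg; have := structure_tame2 (tameD (tame_coord 0) (tame_coord 1)) Cf Cg.
by congr C; apply/funext => x; rewrite !mxE.
Qed.

Lemma structureM f g : C f -> C g -> C (fun x => f x * g x).
Proof.
move=> Cf Cg; have := structure_tame2 (tameM (tame_coord 0) (tame_coord 1)) Cf Cg.
by congr C; apply/funext => x; rewrite !mxE.
Qed.

Lemma structure_flat k f : C f -> C (fun x => flat k (f x)).
Proof.
move=> Cf; have := structure_tame1 (tame_flat k (tame_coord 0)) Cf.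
by congr C; apply/funext => x; rewrite !mxE.
Qed.

Lemma structure_sum (u : nat -> M -> R) n :
  (forall i, C (u i)) -> C (fun x => \sum_(i < n) u i x).
Proof.
move=> Cu; elim: n => [|n ih].
  by under eq_fun do rewrite big_ord0; exact: structure_cst.
by under eq_fun do rewrite big_ord_recr/=; exact: structureD.
Qed.

(** Locality tested on the neighbourhoods [h > c] only: they suffice below, and
    they keep the topology out of the sequel. *)
Lemma structure_local f :
  (forall p, exists h c g,
     [/\ C h, c < h p, C g & forall x, c < h x -> f x = g x]) -> C f.
Proof.
move=> loc; rewrite hC.2 => p; have [h [c [g [Ch hp Cg fg]]]] := loc p.
by exists [set x | c < h x], g; split=> //; exact: open_superlevel.
Qed.

(** For [s > 0], a smooth everywhere positive function of [t] that equals [t]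
    for [t >= s].  The correction term vanishes for [t >= s]; for [t <= 0] it is at least
    [1 + t^2 > -t], which fixes the factor [exp (1/s)], the inverse of
    [flat 0 s]. *)
Definition lifted_id (s t : R) : R :=
  t + expR s^-1 * flat 0 (s - t) * (1 + t * t).

Lemma lifted_id_gt0 s t : 0 < s -> 0 < lifted_id s t.
Proof.
move=> s0; rewrite /lifted_id.
have t21 : 0 < 1 + t * t by nra.
have [t0|t0] := ltP 0 t.
  by rewrite ltr_wpDr// mulr_ge0 ?(ltW t21)// mulr_ge0 ?expR_ge0 ?flat_ge0.
suff K1 : 1 <= expR s^-1 * flat 0 (s - t).
  apply: (@lt_le_trans _ _ (t + (1 + t * t))); first by nra.
  by rewrite lerD2l ler_peMl// ltW.
have st : 0 < s - t by lra.
rewrite /flat st expr0 mul1r -expRD -expR0 ler_expR subr_ge0.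
by rewrite lef_pV2// lerBrDr gerDl.
Qed.

Lemma lifted_id_id s t : s <= t -> lifted_id s t = t.
Proof. by move=> st; rewrite /lifted_id flat_le0 ?subr_le0// mulr0 mul0r addr0. Qed.

(** Near [p], where [h > h p / 2 =: s], the function [t |-> 1/t] may be replaced by
    the globally smooth [1 / lifted_id s]. *)
Lemma structureV h : C h -> (forall x, 0 < h x) -> C (fun x => (h x)^-1).
Proof.
move=> Ch h0; apply: structure_local => p; set s := h p / 2.
have s0 : 0 < s by rewrite divr_gt0.
exists h, s, (fun x => (lifted_id s (h x))^-1); split=> //.
- by rewrite /s ltr_pdivrMr// ltr_pMr// ltr1n.
- have tw : @tame R 1 (fun x => (lifted_id s (x 0 0))^-1).
    apply: tameV; first by move=> x; rewrite gt_eqF// lifted_id_gt0.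
    have tx := @tame_coord R 1 0.
    apply: tameD => //; apply: tameM.
      apply: tameM; first exact: tame_cst.
      apply: tame_flat; apply: tameD; first exact: tame_cst.
      under eq_fun do rewrite -mulN1r.
      by apply: tameM => //; exact: tame_cst.
    by apply: tameD; [exact: tame_cst|exact: tameM].
  have := structure_tame1 tw Ch.
  by congr C; apply/funext => x; rewrite !mxE.
- by move=> x /ltW sx; rewrite lifted_id_id.
Qed.

(** The sum at [x] is cut off at an arbitrary index beyond which all terms
    vanish; it does not depend on that index, so near each point the sum agrees
    with a fixed finite one. *)
Lemma locally_finite_sum (u : nat -> M -> R) :
  (forall n, C (u n)) ->
  (forall p, exists h c N, [/\ C h, c < h p &
     forall x, c < h x -> forall n, (N <= n)%N -> u n x = 0]) ->
  exists2 H, C H & forall x N, (forall n, (N <= n)%N -> u n x = 0) ->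
     H x = \sum_(n < N) u n x.
Proof.
move=> Cu loc.
have stop x : {N | forall n, (N <= n)%N -> u n x = 0}.
  by apply: cid; have [h [c [N [_ hx u0]]]] := loc x; exists N; exact: u0.
have stop_indep x N N' : (forall n, (N <= n)%N -> u n x = 0) ->
    (N <= N')%N -> \sum_(n < N') u n x = \sum_(n < N) u n x.
  move=> u0 NN'; rewrite -(subnKC NN') big_split_ord/= [X in _ + X]big1 ?addr0//.
  by move=> i _; rewrite u0// leq_addr.
pose H x := \sum_(n < sval (stop x)) u n x.
have HE x N : (forall n, (N <= n)%N -> u n x = 0) -> H x = \sum_(n < N) u n x.
  move=> u0; have u0' := svalP (stop x).
  by have [NN'|/ltnW NN'] := leqP N (sval (stop x)); [|symmetry]; exact: stop_indep.
exists H => //; apply: structure_local => p.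
have [h [c [N [Ch hp u0]]]] := loc p.
exists h, c, (fun x => \sum_(n < N) u n x); split=> //; first exact: structure_sum.
by move=> x hx; apply: HE; exact: u0.
Qed.

(** * Characters *)

Section Character.
(** [X] is defined on all functions, with arbitrary values outside [C]; this
    avoids carrying membership proofs. *)
Context (X : (M -> R) -> R).
Context (XD : forall f g, C f -> C g -> X (fun x => f x + g x) = X f + X g).
Context (XM : forall f g, C f -> C g -> X (fun x => f x * g x) = X f * X g).
Context (Xcst : forall a, X (fun=> a) = a).

(** Otherwise [(f - X f)^2] is positive everywhere, hence invertible in [C],
    although [X] kills it. *)
Lemma character_attained f : C f -> exists p, f p = X f.
Proof.
move=> Cf; apply: contrapT => /forallNP fX.
pose d x := f x + - X f; pose h x := d x * d x.
have Cd : C d by apply: structureD => //; exact: structure_cst.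
have Ch : C h by exact: structureM.
have h0 x : 0 < h x.
  by rewrite /h -expr2 exprn_even_gt0//= subr_eq0; apply/eqP; exact: fX.
have CV := structureV Ch h0.
have Xh : X h = 0.
  by rewrite XM// XD ?Xcst ?subrr ?mulr0//; exact: structure_cst.
have := XM Ch CV; rewrite Xh mul0r (_ : (fun x => _) = fun=> 1).
  by rewrite Xcst => /eqP; rewrite oner_eq0.
by apply/funext => x; rewrite divff// gt_eqF.
Qed.

Lemma character_sum (u : nat -> M -> R) n : (forall i, C (u i)) ->
  X (fun x => \sum_(i < n) u i x) = \sum_(i < n) X (u i).
Proof.
move=> Cu; elim: n => [|n ih].
  by rewrite big_ord0; under eq_fun do rewrite big_ord0; exact: Xcst.
rewrite big_ord_recr/= -ih; under eq_fun do rewrite big_ord_recr/=.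
by rewrite XD//; exact: structure_sum.
Qed.

(** If there is no such [p], then [H = \sum_n flat 0 (1 - n S_n)] is a locally
    finite sum; [(H - X H)^2 + S_N] vanishes somewhere by [character_attained],
    but where [S_N] vanishes [H] is at least [N * flat 0 1], which exceeds
    [X H] for large [N]. *)
Lemma character_attained_seq (g : nat -> M -> R) :
  (forall n, C (g n)) -> exists p, forall n, g n p = X (g n).
Proof.
move=> Cg; apply: contrapT => /forallNP noz.
pose d n x := g n x + - X (g n).
pose S n x := \sum_(i < n) d i x * d i x.
have Cd n : C (d n) by apply: structureD => //; exact: structure_cst.
have Cdd n : C (fun x => d n x * d n x) by exact: structureM.
have CS n : C (S n) by apply: (@structure_sum (fun n x => d n x * d n x)).
have XS n : X (S n) = 0.
  rewrite (@character_sum (fun n x => d n x * d n x))//.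
  rewrite big1// => i _; rewrite XM// XD ?Xcst ?subrr ?mulr0//.
  exact: structure_cst.
have dd_ge0 n x : 0 <= d n x * d n x by rewrite -expr2 sqr_ge0.
have S_ge0 n x : 0 <= S n x by apply: sumr_ge0.
have S_mono x m n : (m <= n)%N -> S m x <= S n x.
  move=> mn; rewrite -(subnKC mn) /S big_split_ord/= lerDl.
  exact: sumr_ge0.
have S_pos x : exists m, 0 < S m x.
  have /existsNP[m gm] := noz x; exists m.+1.
  rewrite /S big_ord_recr/= ltr_wpDl//; first exact: S_ge0.
  by rewrite -expr2 exprn_even_gt0//= subr_eq0; apply/eqP.
pose u n x := flat 0 (1 + - n%:R * S n x).
have Cu n : C (u n).
  apply: structure_flat; apply: structureD; first exact: structure_cst.
  by apply: structureM => //; exact: structure_cst.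
(* Near [p], if [S_m p = s > 0], [S_n >= S_m > s / 2] for [n >= m], so [n S_n >= 1] for large
   [n]. *)
have finu p : exists h c N, [/\ C h, c < h p &
    forall x, c < h x -> forall n, (N <= n)%N -> u n x = 0].
  have [m Sm] := S_pos p; set s := S m p in Sm.
  have [N [mN sN]] : exists N, (m <= N)%N /\ 1 <= N%:R * (s / 2).
    exists (maxn m (Num.truncn (s / 2)^-1).+1); split; first exact: leq_maxl.
    rewrite -ler_pdivrMr ?divr_gt0// mul1r.
    apply: (@le_trans _ _ (Num.truncn (s / 2)^-1).+1%:R).
      by apply/ltW/truncnS_gt.
    by rewrite ler_nat leq_maxr.
  exists (S m), (s / 2), N; split=> //.
    by rewrite ltr_pdivrMr// ltr_pMr// ltr1n.
  move=> x sx n Nn; apply: flat_le0; rewrite mulNr subr_le0.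
  apply: le_trans sN _; apply: ler_pM => //; rewrite ?divr_ge0 ?(ltW Sm)//.
    by rewrite ler_nat.
  by apply: (le_trans (ltW sx)); apply: S_mono; exact: leq_trans Nn.
have [H CH HE] := locally_finite_sum Cu finu.
pose c := X H; have f1 : 0 < flat 0 1 :> R by exact: flat_gt0.
pose N := (Num.truncn (c / flat 0 1)).+1.
have cN : c < N%:R * flat 0 1.
  by rewrite -ltr_pdivrMr//; exact: truncnS_gt.
pose e x := H x + - c.
have Ce : C e by apply: structureD => //; exact: structure_cst.
have Cee : C (fun x => e x * e x) by exact: structureM.
have [q] := character_attained (structureD Cee (CS N)).
rewrite XD// XS XM// XD ?Xcst ?subrr ?mulr0 ?addr0//; last exact: structure_cst.
move=> /eqP; rewrite paddr_eq0//; last by rewrite -expr2 sqr_ge0.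
move=> /andP[]; rewrite mulf_eq0 orbb subr_eq0 => /eqP Hq /eqP SNq.
have uq n : (n < N)%N -> u n q = flat 0 1.
  move=> nN; suff S0 : S n q = 0 by rewrite /u S0 mulr0 addr0.
  by apply/eqP; rewrite eq_le S_ge0 andbT -SNq S_mono// ltnW.
have [L uL] : exists L, forall n, (L <= n)%N -> u n q = 0.
  by have [h [b [L [_ hq uL]]]] := finu q; exists L; exact: uL.
have {}uL n : (maxn N L <= n)%N -> u n q = 0.
  by rewrite geq_max => /andP[_]; exact: uL.
(* [H q = X H] has [N] terms equal to [flat 0 1], and the others are >= 0. *)
move: cN; rewrite -Hq (HE _ _ uL) ltNge => /negP; apply.
rewrite -(subnKC (leq_maxl N L)) big_split_ord/=.
rewrite (eq_bigr (fun=> flat 0 1)); last by move=> i _; rewrite uq.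
rewrite sumr_const card_ord mulr_natl lerDl; apply: sumr_ge0 => i _.
exact: flat_ge0.
Qed.

End Character.
End DifferentialStructure.

(** * Countably generated structures *)

(** Prepending [a] makes the enumeration possible for an empty [A], and lets an
    extra function join the generators. *)
Lemma countable_enum (T : choiceType) (A : set T) (a : T) : countable A ->
  exists g : nat -> T, [/\ g 0%N = a, forall n, g n = a \/ A (g n) &
    forall x, A x -> exists n, g n = x].
Proof.
move=> /countable_injP[e e_inj].
exists (fun n => if n is m.+1 then xget a [set x | A x /\ e x = m] else a).
split=> // [[|n]|x Ax]; first by left.
  by case: xgetP => [x _ []|_]; [right|left].
exists (e x).+1.
have [Agx egx] : [set y | A y /\ e y = e x] (xget a [set y | A y /\ e y = e x]).
  by apply: (@xgetI _ _ _ x).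
by apply: e_inj => //; rewrite inE.
Qed.

Theorem corollary6 (R : realType) (M : choiceType) (C : set (M -> R))
  (hM : [set: M] !=set0)
  (hC : differential_structure C)
  (hgen : countably_generated C) :
  smoothly_real_compact C.
Proof.
move=> chi [chiD chiM chiZ chi1].
have [[C0 C0count C0gen] _] := hgen.
have C0C f : C0 f -> C f by rewrite C0gen; exact: sub_generated.
pose X f := if pselect (C f) is left Cf then chi (exist _ f Cf) else 0.
have XE f (Cf : C f) : X f = chi (exist _ f Cf).
  by rewrite /X; case: pselect => // Cf'; congr (chi (exist _ _ _)).
have XD f g : C f -> C g -> X (fun x => f x + g x) = X f + X g.
  by move=> Cf Cg; rewrite (XE _ (structureD hC Cf Cg)) (XE _ Cf) (XE _ Cg); exact: chiD.
have XM f g : C f -> C g -> X (fun x => f x * g x) = X f * X g.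
  by move=> Cf Cg; rewrite (XE _ (structureM hC Cf Cg)) (XE _ Cf) (XE _ Cg); exact: chiM.
have Xcst a : X (fun=> a) = a.
  pose one : {f : M -> R | C f} := exist _ _ (structure_cst hC 1).
  rewrite (XE _ (structure_cst hC a)) (chiZ a one); first by rewrite chi1// mulr1.
  by apply/funext => x /=; rewrite mulr1.
have X_at f : C f ->
    exists p, f p = X f /\ forall g, C0 g -> g p = X g.
  move=> Cf.
  have [g [g0 gC gsurj]] := countable_enum f C0count.
  have [n|p gp] := character_attained_seq hC XD XM Xcst (g := g).
    by case: (gC n) => [->//|/C0C].
  exists p; split; first by rewrite -g0.
  by move=> h /gsurj[n <-].
(* [p] is fixed before [f]; the [q] below depends on [f]. *)
have [p [_ pX]] := X_at _ (structure_cst hC 0).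
exists p; apply/funext => -[f Cf]; rewrite /ev/= -XE.
have [q [<- qX]] := X_at f Cf.
have Cf' : localization (sc C0) f by rewrite -C0gen.
apply: (localization_separates _ Cf') => g; apply: sc_separates => h C0h.
by rewrite qX// pX.
Qed.
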